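(* For $a\in\mathbb{C}$ let $L_{3,a}$ be the $3$-dimensional complex Lie algebra with basis $z_1,z_2,z_3$ and nonzero brackets $[z_3,z_1]=z_2$, $[z_3,z_2]=a z_1+z_2$ (so $[z_1,z_2]=0$). (1) For each $a\in\mathbb{C}-\{-\tfrac14,0\}$, there are (exactly) two subalgebras isomorphic to $L_{3,a}$ in $\mathfrak{so}(4,\mathbb{C})$, up to inner automorphism: $$L_{3,a}^1=\langle x_1,\ x_2,\ (1+\sqrt{1+4a})h_1+(1-\sqrt{1+4a})h_2\rangle,$$ $$L_{3,a}^2=\langle x_1,\ x_2,\ (1-\sqrt{1+4a})h_1+(1+\sqrt{1+4a})h_2\rangle,$$ where the square root $\sqrt{1+4a}$ is always chosen in the upper half-plane or on the positive real axis. (2) There is no subalgebra isomorphic to $L_{3,-\frac14}$ in $\mathfrak{so}(4,\mathbb{C})$. (3) There are (exactly) four subalgebras in $\mathfrak{so}(4,\mathbb{C})$ isomorphic to $L_{3,0}$, up to inner automorphism: $$L_{3,0}^1=\langle h_1,x_2,h_2\rangle,\quad L_{3,0}^2=\langle x_1,x_2,h_2\rangle,\quad L_{3,0}^3=\langle x_1,h_1,h_2\rangle,\quad L_{3,0}^4=\langle x_1,h_1,x_2\rangle.$$ Here, in (1) and (3), the listed subalgebras are pairwise inequivalent and every subalgebra isomorphic to the given Lie algebra is equivalent to one of them.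
   Context: $\mathfrak{so}(4,\mathbb{C})\cong\mathfrak{sl}(2,\mathbb{C})\oplus\mathfrak{sl}(2,\mathbb{C})$ is realized as the Lie algebra of $4\times4$ complex block diagonal matrices with two traceless $2\times 2$ diagonal blocks. With $E_{ij}$ the $4\times 4$ matrix units, its Chevalley basis is $x_1=E_{12}$, $y_1=E_{21}$, $h_1=E_{11}-E_{22}$, $x_2=E_{34}$, $y_2=E_{43}$, $h_2=E_{33}-E_{44}$. The notation $\langle\cdots\rangle$ denotes complex linear span. The inner automorphisms of $\mathfrak{so}(4,\mathbb{C})$ are the maps $X\mapsto AXA^{-1}$ with $A\in SL(2,\mathbb{C})\times SL(2,\mathbb{C})$ (block diagonal $4\times4$ matrices with both $2\times2$ blocks of determinant $1$). Two subalgebras $S,S'$ are equivalent (up to inner automorphism), written $S\sim S'$, if $\psi(S)=S'$ for some inner automorphism $\psi$ of $\mathfrak{so}(4,\mathbb{C})$. The upper half-plane is $\{z\in\mathbb{C}:\operatorname{Im} z>0\}$. *)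

(* Defs.v *)
From HB Require Import structures.
From mathcomp Require Import all_boot all_order all_algebra.
From mathcomp Require Import complex ring.
From mathcomp Require Import reals.

Set Implicit Arguments.
Unset Strict Implicit.
Unset Printing Implicit Defensive.

Import Order.TTheory GRing.Theory Num.Theory.
Local Open Scope ring_scope.

(* The branch of [sqrtC]: upper half-plane or positive real axis (recall that
   0 < s in a [numClosedFieldType] entails that s is real). *)
Lemma sqrtC_branch (C : numClosedFieldType) (z : C) :
  z != 0 -> (0 < 'Im (sqrtC z)) || (0 < sqrtC z).
Proof.
move=> z0; rewrite lt0r Im_rootC_ge0 // andbT.
case: eqP => //= /Creal_ImP sR.
by rewrite lt0r sqrtC_eq0 z0 /= sqrtC_ge0 -[z]sqrtCK real_exprn_even_ge0.
Qed.

Section Defs.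
Variable R : realType.
Local Notation C := R[i].
Local Notation M4 := 'M[C]_(2 + 2).
Implicit Types (X Y A : M4) (S : {vspace M4}).

Definition lie X Y : M4 := X *m Y - Y *m X.

Definition so4 : {pred M4} :=
  [pred X : M4 | [&& ursubmx X == 0, dlsubmx X == 0,
                     \tr (ulsubmx X) == 0 & \tr (drsubmx X) == 0]].

(* 1-based matrix units, only used for 1 <= i, j <= 4 *)
Definition E (i j : nat) : M4 := delta_mx (inord i.-1) (inord j.-1).

Definition x1 : M4 := E 1 2.
Definition y1 : M4 := E 2 1.
Definition h1 : M4 := E 1 1 - E 2 2.
Definition x2 : M4 := E 3 4.
Definition y2 : M4 := E 4 3.
Definition h2 : M4 := E 3 3 - E 4 4.

Definition subalgebra S : Prop :=
  {subset S <= so4} /\ {in S &, forall X Y, lie X Y \in S}.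

Definition SL2xSL2 A : Prop :=
  exists P Q : 'M[C]_2, [/\ \det P = 1, \det Q = 1 & A = block_mx P 0 0 Q].

Definition inner_aut A : 'End(M4) :=
  linfun (mulmxr (invmx A) \o mulmx A).

Lemma inner_autE A X : inner_aut A X = A *m X *m invmx A.
Proof. by rewrite lfunE. Qed.

Definition equivalent S S' : Prop :=
  exists2 A, SL2xSL2 A & (inner_aut A @: S)%VS = S'.

(* L_{3,a} is carried by C^3, with z_1, z_2, z_3 the canonical basis. *)
Definition z (k : nat) : 'rV[C]_3 := delta_mx 0 (inord k.-1).

Definition L3_bracket (a : C) (u v : 'rV[C]_3) : 'rV[C]_3 :=
  let c (w : 'rV[C]_3) k := w 0 (inord k.-1) in
  (c u 3 * c v 1 - c u 1 * c v 3) *: z 2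
  + (c u 3 * c v 2 - c u 2 * c v 3) *: (a *: z 1 + z 2).

Lemma z_coord j k : (0 < j <= 3)%N -> (0 < k <= 3)%N ->
  z j 0 (inord k.-1) = (k == j)%:R.
Proof.
case: j k => [|j] [|k] //= jlt klt.
by rewrite mxE /= -val_eqE /= !inordK.
Qed.

Lemma L3_bracket12 a : L3_bracket a (z 1) (z 2) = 0.
Proof. by rewrite /L3_bracket !z_coord //= !(mul0r, mulr0) subrr !scale0r addr0. Qed.

Lemma L3_bracket31 a : L3_bracket a (z 3) (z 1) = z 2.
Proof.
by rewrite /L3_bracket !z_coord //= !(mul0r, mulr0, mulr1) subrr subr0 scale0r
  scale1r addr0.
Qed.

Lemma L3_bracket32 a : L3_bracket a (z 3) (z 2) = a *: z 1 + z 2.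
Proof.
by rewrite /L3_bracket !z_coord //= !(mul0r, mulr0, mulr1) subrr subr0 scale0r
  scale1r add0r.
Qed.

Lemma L3_bracket_linear a u : linear (L3_bracket a u).
Proof. by move=> k v w; apply/rowP => i; rewrite !mxE; ring. Qed.

Lemma L3_bracketvv a u : L3_bracket a u u = 0.
Proof. by apply/rowP => i; rewrite !mxE; ring. Qed.

Lemma L3_bracketC a u v : L3_bracket a u v = - L3_bracket a v u.
Proof. by apply/rowP => i; rewrite !mxE; ring. Qed.

Lemma L3_jacobi a u v w :
  L3_bracket a u (L3_bracket a v w) + L3_bracket a v (L3_bracket a w u)
  + L3_bracket a w (L3_bracket a u v) = 0.
Proof.
rewrite /L3_bracket; apply/rowP => i.
rewrite !mxE -!val_eqE /= !inordK //=; ring.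
Qed.

(* S is the image of an injective Lie algebra morphism from L_{3,a} *)
Definition isom_L3 (a : C) S : Prop :=
  exists f : 'Hom('rV[C]_3, M4),
    [/\ lker f = 0%VS, limg f = S &
        forall u v, f (L3_bracket a u v) = lie (f u) (f v)].

Definition classifies (a : C) (Ls : seq {vspace M4}) : Prop :=
  [/\ forall L, L \in Ls -> subalgebra L /\ isom_L3 a L,
      forall i j, (i < size Ls)%N -> (j < size Ls)%N -> i <> j ->
        ~ equivalent (nth 0%VS Ls i) (nth 0%VS Ls j)
    & forall S, subalgebra S -> isom_L3 a S ->
        exists2 L, L \in Ls & equivalent S L].

Definition L3a1 (a : C) : {vspace M4} :=
  let s := sqrtC (1 + 4 * a) in
  <<[:: x1; x2; ((1 + s) *: h1 + (1 - s) *: h2)%R]>>%VS.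
Definition L3a2 (a : C) : {vspace M4} :=
  let s := sqrtC (1 + 4 * a) in
  <<[:: x1; x2; ((1 - s) *: h1 + (1 + s) *: h2)%R]>>%VS.

Definition L301 : {vspace M4} := <<[:: h1; x2; h2]>>%VS.
Definition L302 : {vspace M4} := <<[:: x1; x2; h2]>>%VS.
Definition L303 : {vspace M4} := <<[:: x1; h1; h2]>>%VS.
Definition L304 : {vspace M4} := <<[:: x1; h1; x2]>>%VS.

End Defs.

Arguments L301 {R}.
Arguments L302 {R}.
Arguments L303 {R}.
Arguments L304 {R}.

(* Main.v *)
(* L_{3,a} is spanned by an abelian pair e, c and an element w with
   [w, e] = l e and [w, c] = m c, where l, m are the roots of t^2 - t - a, as
   long as l <> m. Inside sl2 + sl2 everything splits into two 2x2 components.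
   There (ad W)^3 is a multiple of ad W, so ad W has no Jordan block at a nonzero
   eigenvalue, which excludes a = -1/4, and two nonzero eigenvalues of ad W are
   equal or opposite. As l + m = 1, for a <> 0 this puts e and c into different
   factors; for a = 0 the element c is central, so that in each factor e or c
   vanishes. What is left is the normal form of a Borel pair under SL2, and of
   the single matrix c when a = 0: nilpotent or semisimple, in either factor. *)

Require Import Defs.
From HB Require Import structures.
From mathcomp Require Import all_boot all_order all_algebra.
From mathcomp Require Import complex ring.
From mathcomp Require Import reals.
Set Implicit Arguments.
Unset Strict Implicit.
Unset Printing Implicit Defensive.
Import Order.TTheory GRing.Theory Num.Theory.
Local Open Scope ring_scope.

(** * Traceless 2x2 matrices and their bracket, in coordinates *)

Definition mx2 (F : nzRingType) (a b c d : F) : 'M[F]_2 :=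
  \matrix_(i, j) (if i == 0 then if j == 0 then a else b
                  else if j == 0 then c else d).

Definition br (F : nzRingType) (U V : 'M[F]_2) : 'M[F]_2 := U *m V - V *m U.

Section TwoByTwo.
Variable F : fieldType.
Implicit Types (a b c d k : F) (U V W P : 'M[F]_2).

Lemma ord2P (Q : 'I_2 -> Prop) : Q 0 -> Q 1 -> forall i, Q i.
Proof.
move=> Q0 Q1 [[|[|//]] lti].
- by have -> : Ordinal lti = 0 by apply/val_inj.
- by have -> : Ordinal lti = 1 by apply/val_inj.
Qed.

Lemma mx2_eq U V : U 0 0 = V 0 0 -> U 0 1 = V 0 1 -> U 1 0 = V 1 0 ->
  U 1 1 = V 1 1 -> U = V.
Proof. by move=> *; apply/matrixP; apply: ord2P; apply: ord2P. Qed.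

Lemma mx2E U : U = mx2 (U 0 0) (U 0 1) (U 1 0) (U 1 1).
Proof. by apply: mx2_eq; rewrite !mxE. Qed.

Lemma mx2_inj a b c d a' b' c' d' :
  mx2 a b c d = mx2 a' b' c' d' -> [/\ a = a', b = b', c = c' & d = d'].
Proof.
move=> /matrixP eqm; split.
- by have := eqm 0 0; rewrite !mxE.
- by have := eqm 0 1; rewrite !mxE.
- by have := eqm 1 0; rewrite !mxE.
- by have := eqm 1 1; rewrite !mxE.
Qed.

Lemma mx2M a b c d a' b' c' d' :
  mx2 a b c d *m mx2 a' b' c' d' =
  mx2 (a * a' + b * c') (a * b' + b * d') (c * a' + d * c') (c * b' + d * d').
Proof. by apply: mx2_eq; rewrite !mxE !big_ord_recl big_ord0 addr0 !mxE. Qed.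

Lemma det_mx2 a b c d : \det (mx2 a b c d) = a * d - b * c.
Proof.
rewrite (expand_det_row _ 0) !big_ord_recl big_ord0 addr0 /cofactor !det_mx11.
by rewrite !mxE /= expr0 expr1 mul1r mulN1r mulrN.
Qed.

(* A traceless 2x2 matrix in coordinates: [sl a b c] is a h + b x + c y. *)
Definition sl a b c := mx2 a b c (- a).

Lemma sl_inj a b c a' b' c' :
  sl a b c = sl a' b' c' -> [/\ a = a', b = b' & c = c'].
Proof. by case/mx2_inj. Qed.

Lemma trace0P U : \tr U = 0 -> {a & {b & {c | U = sl a b c}}}.
Proof.
rewrite /mxtrace !big_ord_recl big_ord0 addr0 => /eqP.
rewrite addrC addr_eq0 => /eqP tr0.
exists (U 0 0), (U 0 1), (U 1 0); rewrite {1}(mx2E U) /sl -tr0.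
by congr (mx2 _ _ _ (U _ _)); apply/val_inj.
Qed.

Lemma trace_sl a b c : \tr (sl a b c) = 0.
Proof. by rewrite /mxtrace !big_ord_recl big_ord0 !mxE /= addr0 subrr. Qed.

Lemma sl0 : sl 0 0 0 = 0.
Proof. by apply: mx2_eq; rewrite !mxE /= ?oppr0. Qed.

Lemma slD a b c a' b' c' :
  sl a b c + sl a' b' c' = sl (a + a') (b + b') (c + c').
Proof. by apply: mx2_eq; rewrite !mxE //= opprD. Qed.

Lemma slZ k a b c : k *: sl a b c = sl (k * a) (k * b) (k * c).
Proof. by apply: mx2_eq; rewrite !mxE //= mulrN. Qed.

Lemma br_sl a b c a' b' c' : br (sl a b c) (sl a' b' c') =
  sl (b * c' - b' * c) (2 * (a * b' - a' * b)) (2 * (c * a' - c' * a)).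
Proof.
by rewrite /br !mx2M; apply: mx2_eq; rewrite !mxE /=; ring.
Qed.

Lemma brZr k U V : br U (k *: V) = k *: br U V.
Proof. by rewrite /br -scalemxAl -scalemxAr scalerBr. Qed.

Lemma brDr U V W : br U (V + W) = br U V + br U W.
Proof. by rewrite /br mulmxDr mulmxDl opprD addrACA. Qed.

(* ad W has eigenvalues 0 and the two square roots of -4 det W. *)
Lemma br_cubed W V : \tr W = 0 -> \tr V = 0 ->
  br W (br W (br W V)) = (- 4 * \det W) *: br W V.
Proof.
case/trace0P=> [a [b [c ->]]] /trace0P[a' [b' [c' ->]]].
by rewrite !br_sl slZ det_mx2; congr sl; ring.
Qed.

(** Evaluating [br_cubed] at an eigenvector gives k^3 V = -4 k det W V, where k and V cancel. *)
Lemma br_eigenvalue_sqr W V k : \tr W = 0 -> \tr V = 0 -> k != 0 -> V != 0 ->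
  br W V = k *: V -> k ^+ 2 = - 4 * \det W.
Proof.
move=> trW trV k0 V0 eqV; have := br_cubed trW trV.
rewrite eqV !brZr eqV !brZr eqV !scalerA => /eqP.
rewrite -subr_eq0 -scalerBl scaler_eq0 (negPf V0) orbF.
rewrite -mulrA mulrC -mulrBl mulf_eq0 (negPf k0) orbF subr_eq0 => /eqP <-.
by rewrite expr2.
Qed.

(** If U and V were both nonzero, k^2 and l^2 would both equal -4 det W, so that k = l or k = -l. *)
Lemma br_eigenvalues_dependent W U V k l : \tr W = 0 -> \tr U = 0 ->
  \tr V = 0 -> k != 0 -> l != 0 -> k != l -> k + l != 0 ->
  br W U = k *: U -> br W V = l *: V -> U = 0 \/ V = 0.
Proof.
move=> trW trU trV k0 l0 kl kl0 eqU eqV.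
have [->|U0] := eqVneq U 0; first by left.
have [->|V0] := eqVneq V 0; first by right.
have := br_eigenvalue_sqr trW trU k0 U0 eqU.
rewrite -(br_eigenvalue_sqr trW trV l0 V0 eqV) => /eqP.
by rewrite eqf_sqr -addr_eq0 (negPf kl) (negPf kl0).
Qed.

(** On such a Jordan block (ad W)^3 U = k^3 U + 3 k^2 V, whereas [br_cubed] turns it into k^2 (ad W)
    U = k^3 U + k^2 V; the difference 2 k^2 V must vanish. *)
Lemma br_no_jordan W U V k : 2 != 0 :> F -> \tr W = 0 -> \tr U = 0 ->
  \tr V = 0 -> k != 0 ->
  br W U = k *: U + V -> br W V = k *: V -> V = 0.
Proof.
move=> two trW trU trV k0 eqU eqV; apply/eqP/negPn/negP => V0.
have := br_cubed trW trU.
rewrite -(br_eigenvalue_sqr trW trV k0 V0 eqV).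
rewrite eqU (brDr W (k *: U)) brZr eqU eqV brDr !brZr (brDr W (k *: U)).
rewrite brZr eqU eqV => /eqP; rewrite -subr_eq0.
set D := (X in X == 0); have -> : D = (2 * k ^+ 2) *: V.
  apply/matrixP => i j; rewrite !mxE; ring.
by rewrite scaler_eq0 (negPf V0) !mulf_eq0 (negPf two) (negPf k0).
Qed.

(** By cyclicity of the trace, tr (V [W, V]) = 0. For an eigenvector this is k tr (V^2) = -2 k det
    V; the computation is this identity in coordinates. *)
Lemma br_eigen_det0 W V k : 2 != 0 :> F -> \tr W = 0 -> \tr V = 0 -> k != 0 ->
  br W V = k *: V -> \det V = 0.
Proof.
move=> two.
case/trace0P=> [a [b [c ->]]] /trace0P[a' [b' [c' ->]]] k0.
rewrite br_sl slZ det_mx2 => /sl_inj[e1 e2 e3].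
have/eqP : 2 * k * (a' * - a' - b' * c') = 0.
  transitivity (- (2 * a' * (k * a') + c' * (k * b') + b' * (k * c'))).
    by ring.
  by rewrite -e1 -e2 -e3; ring.
by rewrite !mulf_eq0 (negPf two) (negPf k0) => /eqP.
Qed.


Lemma br_conj P U V : P \in unitmx ->
  br (P *m U *m invmx P) (P *m V *m invmx P) = P *m br U V *m invmx P.
Proof.
by move=> uP; rewrite /br mulmxBr mulmxBl !mulmxA !(mulmxKV uP).
Qed.

(** Normal forms are stated as P U = V P, which involves no inverse and can be checked by [ring];
    this converts them into conjugations. *)
Lemma conj_eqP P U V : P \in unitmx -> P *m U = V *m P ->
  P *m U *m invmx P = V.
Proof. by move=> uP ->; rewrite mulmxK. Qed.

Lemma det1_unitmx n (P : 'M[F]_n) : \det P = 1 -> P \in unitmx.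
Proof. by rewrite unitmxE => ->; rewrite unitr1. Qed.

Lemma det_conj P U : P \in unitmx -> \det (P *m U *m invmx P) = \det U.
Proof.
move=> uP; rewrite !det_mulmx mulrAC -det_mulmx mulmxV // det1 mul1r //.
Qed.

Lemma conj_eq0 P U : P \in unitmx -> (P *m U *m invmx P == 0) = (U == 0).
Proof.
move=> uP; apply/eqP/eqP => [eq0|->]; last by rewrite mulmx0 mul0mx.
by rewrite -[U](mulKmx uP) -[P *m U](mulmxKV uP) eq0 mul0mx mulmx0.
Qed.

End TwoByTwo.

(** * Normal forms under conjugation by SL2, and centralizers *)

Section NormalForms.
Variable C : numClosedFieldType.
Implicit Types (a b c k : C) (U V W P : 'M[C]_2).

(* If the row p satisfies p V <> 0, the rows p and p V form a matrix P with
   P V = E12 P; scaling p by a square root makes its determinant 1. *)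
Lemma nilpotent_normal_form V : \tr V = 0 -> \det V = 0 -> V != 0 ->
  exists2 P, \det P = 1 & P *m V = sl 0 1 0 *m P.
Proof.
case/trace0P=> [a [b [c ->]]]; rewrite det_mx2 => d0 V0.
have bcE : b * c = - (a * a).
  by apply/eqP; rewrite -addr_eq0 -oppr_eq0 -[X in _ == X]d0; apply/eqP; ring.
(* The quantity is the determinant of the rows p and p V, a quadratic form in the row (p, q) with
   square coefficients b and -c. A basis row makes it nonzero unless b = c = 0, and then a = 0 as
   well. *)
have [p [q dpq]] : exists p q, p * (p * b - q * a) - q * (p * a + q * c) != 0.
  have [b0|b0] := eqVneq b 0; last first.
    by exists 1, 0; rewrite !mul0r !mul1r !subr0.
  have [c0|c0] := eqVneq c 0; last first.
    by exists 0, 1; rewrite !mul0r !mul1r !add0r oppr_eq0.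
  move: bcE V0; rewrite b0 mul0r => /esym/eqP.
  rewrite oppr_eq0 mulf_eq0 orbb => /eqP ->.
  by rewrite c0 sl0 eqxx.
set d := (X in X != 0) in dpq; pose r := (sqrtC d)^-1.
have rd : r ^+ 2 * d = 1 by rewrite exprVn sqrtCK mulVf.
exists (mx2 (r * p) (r * q) (r * (p * a + q * c)) (r * (p * b - q * a))).
  by rewrite det_mx2 -rd /d; ring.
rewrite !mx2M; congr mx2; try ring.
(* The second row of P is killed by V because V^2 = (a^2 + b c) I = 0. *)
- transitivity (r * p * (a * a + b * c)); first by ring.
  by rewrite bcE; ring.
- transitivity (r * q * (a * a + b * c)); first by ring.
  by rewrite bcE; ring.
Qed.

(* The rows of V + m and V - m, where m^2 = - det V, are left eigenvectors. *)
Lemma semisimple_normal_form V : \tr V = 0 -> \det V != 0 ->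
  exists P m, [/\ \det P = 1, m != 0 & P *m V = sl m 0 0 *m P].
Proof.
case/trace0P=> [a [b [c ->]]]; rewrite det_mx2 => d0.
have [/andP[/eqP b0 /eqP c0]|bc0] := boolP ((b == 0) && (c == 0)).
  exists 1%:M, a; rewrite det1 mul1mx mulmx1 b0 c0; split => //.
  by apply: contraNneq d0 => ->; rewrite b0 !mul0r subrr.
pose m := sqrtC (a * a + b * c).
have mE : m * m = a * a + b * c by rewrite -expr2 sqrtCK.
have m0 : m != 0.
  rewrite sqrtC_eq0; apply: contraNneq d0 => e.
  by rewrite mulrN -opprD e oppr0.
have two0 : 2 != 0 :> C by rewrite pnatr_eq0.
(* For b = 0 the first rows of V + m and V - m are parallel, so the second rows are taken; otherwise
   the first rows serve. The upper row is divided by the determinant of the pair, -2 m c or 2 m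
   b. *)
have [b0|b0] := eqVneq b 0.
  have c0 : c != 0 by move: bc0; rewrite b0 eqxx.
  have n0 : - 2 * m * c != 0 by rewrite !mulf_neq0 ?oppr_eq0.
  exists (mx2 (c / (- 2 * m * c)) ((m - a) / (- 2 * m * c)) c (- a - m)), m.
  split=> //; first by rewrite det_mx2 -[RHS](mulfV n0); ring.
  rewrite !mx2M; congr mx2; try ring.
  - transitivity ((c * b - (m - a) * a) / (- 2 * m * c)); first by ring.
    transitivity ((m * m - m * a) / (- 2 * m * c)); last by ring.
    by congr (_ / _); rewrite mE; ring.
  - transitivity (m * a + (a * a + b * c)); first by ring.
    by rewrite -mE; ring.
have n0 : 2 * m * b != 0 by rewrite !mulf_neq0.
exists (mx2 ((a + m) / (2 * m * b)) (b / (2 * m * b)) (a - m) b), m.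
split=> //; first by rewrite det_mx2 -[RHS](mulfV n0); ring.
rewrite !mx2M; congr mx2; try ring.
- transitivity ((a * a + b * c + m * a) / (2 * m * b)); first by ring.
  by rewrite -mE; ring.
- transitivity (a * a + b * c - m * a); first by ring.
  by rewrite -mE; ring.
Qed.

(** An eigenvector for a nonzero eigenvalue is nilpotent, so V can be moved to E12. The eigenvector
    equation then makes W upper triangular with diagonal entry k / 2. The corner entry c stays free:
    it is a multiple of E12, which later disappears in the span. *)
Lemma borel_normal_form W V k : \tr W = 0 -> \tr V = 0 -> k != 0 -> V != 0 ->
  br W V = k *: V ->
  exists P c, [/\ \det P = 1, P *m V = sl 0 1 0 *m P
               & P *m W = sl (k / 2) c 0 *m P].
Proof.
move=> trW trV k0 V0 eqV.
have two0 : 2 != 0 :> C by rewrite pnatr_eq0.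
have [P detP PV] := nilpotent_normal_form trV
  (br_eigen_det0 two0 trW trV k0 eqV) V0.
have uP := det1_unitmx detP.
have trW' : \tr (P *m W *m invmx P) = 0 by rewrite mxtrace_mulC mulKmx.
have [a [b [c W'E]]] := trace0P trW'.
have := br_conj W V uP; rewrite eqV -scalemxAr -scalemxAl (conj_eqP uP PV).
(* Here [e1] reads - c = 0 and [e2] reads 2 a = k, up to trivial factors. *)
rewrite W'E br_sl slZ => /sl_inj[e1 e2 _].
exists P, b; split=> //; rewrite -[P *m W](mulmxKV uP) W'E.
congr (sl _ _ _ *m _).
  apply/eqP; rewrite eq_sym -subr_eq0 -(mulrI_eq0 _ (mulfI two0)); apply/eqP.
  by rewrite mulrBr mulrCA mulfV // mulr1 -[k]mulr1 -e2; ring.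
by apply/eqP; rewrite -oppr_eq0; apply/eqP; rewrite -[RHS](mulr0 k) -e1; ring.
Qed.

(** Up to factors 2 the bracket is the cross product of the coordinate vectors, so its vanishing
    means proportionality; the ratio is read off at a nonzero coordinate of V. *)
Lemma commuting_multiple W V : \tr W = 0 -> \tr V = 0 -> V != 0 ->
  br W V = 0 -> exists k, W = k *: V.
Proof.
case/trace0P=> [a [b [c ->]]] /trace0P[a' [b' [c' ->]]] V0.
have two0 : 2 != 0 :> C by rewrite pnatr_eq0.
rewrite br_sl -sl0 => /sl_inj[/eqP e1 /eqP e2 /eqP e3].
move: e1 e2 e3; rewrite !mulf_eq0 !(negPf two0) !subr_eq0 /=.
move=> /eqP e1 /eqP e2 /eqP e3.
have [a0|a0] := eqVneq a' 0; last first.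
  exists (a / a'); rewrite slZ; congr sl.
  - by rewrite mulfVK.
  - by rewrite mulrAC e2 mulrAC mulfV // mul1r.
  - by rewrite mulrAC [a * c']mulrC -e3 mulfK.
have [b0|b0] := eqVneq b' 0; last first.
  exists (b / b'); rewrite slZ; congr sl.
  - by apply: (mulIf b0); rewrite e2 a0; ring.
  - by rewrite mulfVK.
  - by rewrite mulrAC e1 mulrAC mulfV // mul1r.
have c0 : c' != 0 by apply: contraNneq V0 => ->; rewrite a0 b0 sl0.
exists (c / c'); rewrite slZ; congr sl; last by rewrite mulfVK.
  by apply: (mulIf c0); rewrite mulrC -e3 a0; ring.
by apply: (mulIf c0); rewrite e1 b0; ring.
Qed.

(** If U were nonzero, V would be a multiple of U and would commute with W, against [W, V] = k V
    with k V nonzero. *)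
Lemma borel_centralizer W V U k : \tr W = 0 -> \tr V = 0 -> \tr U = 0 ->
  k != 0 -> V != 0 -> br W V = k *: V -> br W U = 0 -> br V U = 0 -> U = 0.
Proof.
move=> trW trV trU k0 V0 eqV WU VU; apply/eqP/negPn/negP => U0.
have [l VE] := commuting_multiple trV trU U0 VU.
move: eqV; rewrite VE brZr WU scaler0 => /esym/eqP.
by rewrite scaler_eq0 (negPf k0) -VE (negPf V0).
Qed.

End NormalForms.

(** * Spans of three vectors *)

Section ThreeSpans.
Variables (F : fieldType) (vT : vectType F).
Implicit Types (u v w x y z : vT) (S : {vspace vT}).

Lemma memv_span3 u v w x :
  (exists a b c, x = a *: u + b *: v + c *: w) <-> x \in <<[:: u; v; w]>>%VS.
Proof.
rewrite !span_cons span_nil addv0; split.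
  case=> a [b [c ->]]; rewrite -addrA.
  apply: memv_add; first by rewrite memvZ ?memv_line.
  by apply: memv_add; rewrite memvZ ?memv_line.
case/memv_addP=> _ /vlineP[a ->] [t tvw ->].
have [_ /vlineP[b ->] [_ /vlineP[c ->] ->]] := memv_addP tvw.
by exists a, b, c; rewrite addrA.
Qed.

Lemma span3_sub u v w S :
  u \in S -> v \in S -> w \in S -> (<<[:: u; v; w]>> <= S)%VS.
Proof.
by move=> uS vS wS; apply/span_subvP => x; rewrite !inE => /or3P[] /eqP ->.
Qed.

Lemma span3_eq x y z x' y' z' :
  x \in <<[:: x'; y'; z']>>%VS -> y \in <<[:: x'; y'; z']>>%VS ->
  z \in <<[:: x'; y'; z']>>%VS -> x' \in <<[:: x; y; z]>>%VS ->
  y' \in <<[:: x; y; z]>>%VS -> z' \in <<[:: x; y; z]>>%VS ->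
  <<[:: x; y; z]>>%VS = <<[:: x'; y'; z']>>%VS.
Proof.
by move=> *; apply/eqP; rewrite eqEsubv; apply/andP; split; apply: span3_sub.
Qed.

Lemma span3_swap x y z : <<[:: x; y; z]>>%VS = <<[:: y; x; z]>>%VS.
Proof. by apply: eq_span => t; rewrite !inE orbCA. Qed.

Lemma span3_swapr x y z : <<[:: x; y; z]>>%VS = <<[:: x; z; y]>>%VS.
Proof. by apply: eq_span => t; rewrite !inE [(_ == y) || _]orbC. Qed.

Definition independent3 u v w := forall a b c : F,
  a *: u + b *: v + c *: w = 0 -> [/\ a = 0, b = 0 & c = 0].

End ThreeSpans.

(** * Passage from the basis z_1, z_2, z_3 to eigenvectors of ad z_3 *)

Section EigenChange.
Variables (F : fieldType) (p q : nat) (l m : F) (u1 u2 u3 : 'M[F]_(p, q)).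
Hypothesis lm : l != m.

(** The change of basis on the first two vectors has determinant l - m. Working with matrices
    instead of an abstract vector space lets [field] verify the relations entrywise. *)
Lemma eigen_change_span : <<[:: u1; u2; u3]>>%VS =
  <<[:: u2 - m *: u1; u2 - l *: u1; u3]>>%VS.
Proof.
have lm0 : l - m != 0 by rewrite subr_eq0.
apply: span3_eq; apply/memv_span3.
- exists (l - m)^-1, (- (l - m)^-1), 0.
  by apply/matrixP => i j; rewrite !mxE; field.
- exists (l / (l - m)), (- m / (l - m)), 0.
  by apply/matrixP => i j; rewrite !mxE; field.
- by exists 0, 0, 1; rewrite !scale0r scale1r !add0r.
- by exists (- m), 1, 0; rewrite scale0r scale1r addr0 scaleNr addrC.
- by exists (- l), 1, 0; rewrite scale0r scale1r addr0 scaleNr addrC.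
- by exists 0, 0, 1; rewrite !scale0r scale1r !add0r.
Qed.

Lemma eigen_change_independent : independent3 u1 u2 u3 ->
  independent3 (u2 - m *: u1) (u2 - l *: u1) u3.
Proof.
have lm0 : l - m != 0 by rewrite subr_eq0.
move=> ind x y t e0; have [] := ind (- (x * m) - y * l) (x + y) t.
  by rewrite -e0; apply/matrixP => i j; rewrite !mxE; ring.
move=> e1 /eqP; rewrite addr_eq0 => /eqP xE t0; move: e1; rewrite xE => /eqP.
have -> : - (- y * m) - y * l = - (y * (l - m)) by ring.
by rewrite oppr_eq0 mulf_eq0 (negPf lm0) orbF => /eqP ->; rewrite oppr0.
Qed.

End EigenChange.

(** * Bases of the copies of L_{3,a} among 4x4 matrices *)

Section Lie.
Variable R : realType.
Local Notation C := R[i].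
Local Notation M4 := 'M[C]_(2 + 2).
Implicit Types (X Y Z e c w : M4) (a k : C) (S : {vspace M4}).

Lemma lieDl X Y Z : lie (X + Y) Z = lie X Z + lie Y Z.
Proof. by rewrite /lie mulmxDr mulmxDl opprD addrACA. Qed.

Lemma lieN X Y : lie X Y = - lie Y X.
Proof. by rewrite /lie opprB. Qed.

Lemma lievv X : lie X X = 0.
Proof. exact: subrr. Qed.

Lemma lieDr X Y Z : lie X (Y + Z) = lie X Y + lie X Z.
Proof. by rewrite lieN lieDl opprD -!lieN. Qed.

Lemma lieZl k X Y : lie (k *: X) Y = k *: lie X Y.
Proof. by rewrite /lie -scalemxAl -scalemxAr scalerBr. Qed.

Lemma lieZr k X Y : lie X (k *: Y) = k *: lie X Y.
Proof. by rewrite lieN lieZl -scalerN -lieN. Qed.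

(** The vectors are the images of z_1, z_2, z_3; their independence is the injectivity of the
    morphism. *)
Lemma isom_L3_basis a S : isom_L3 a S -> exists u1 u2 u3,
  [/\ S = <<[:: u1; u2; u3]>>%VS, independent3 u1 u2 u3
    & [/\ lie u1 u2 = 0, lie u3 u1 = u2 & lie u3 u2 = a *: u1 + u2]].
Proof.
case=> f [/eqP/lker0P finj <- fM].
have zE (v : 'rV[C]_3) :
    v = v 0 (inord 0) *: z R 1 + v 0 (inord 1) *: z R 2
        + v 0 (inord 2) *: z R 3.
  apply/rowP => -[[|[|[|//]]] lti]; rewrite !mxE /= -!val_eqE /= !inordK //=;
    rewrite ?mulr1 ?mulr0 ?addr0 ?add0r; congr (v _ _); apply/val_inj;
    by rewrite /= inordK.
exists (f (z R 1)), (f (z R 2)), (f (z R 3)); split.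
- apply/vspaceP => X; apply/idP/idP.
    case/memv_imgP=> v _ ->; apply/memv_span3; rewrite [in f v](zE v).
    by exists (v 0 (inord 0)), (v 0 (inord 1)), (v 0 (inord 2));
      rewrite 2!(linearD f) 3!(linearZZ f).
  by apply/subvP: X; apply: span3_sub; rewrite memv_img ?memvf.
- move=> x y t; rewrite -!linearZ -!linearD -[RHS](linear0 f) => /finj/rowP e.
  have e0 i : (x *: z R 1 + y *: z R 2 + t *: z R 3) 0 i = 0.
    by rewrite e mxE.
  have := e0 (inord 0); have := e0 (inord 1); have := e0 (inord 2).
  rewrite !mxE /= -!val_eqE /= !inordK //=.
  by rewrite ?mulr1 ?mulr0 ?addr0 ?add0r.
- rewrite -!fM L3_bracket12 L3_bracket31 L3_bracket32.
  by rewrite !linearD !linearZ linear0.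
Qed.

(** On the span of u1 and u2, ad u3 is the companion matrix of t^2 - t - a, whose roots are l and m.
    Then u2 - m u1 is an eigenvector for l, and u2 - l u1 one for m. *)
Lemma isom_L3_eigenbasis a l m S : l + m = 1 -> l * m = - a -> l != m ->
  isom_L3 a S -> exists e c w,
  [/\ S = <<[:: e; c; w]>>%VS, independent3 e c w
    & [/\ lie e c = 0, lie w e = l *: e & lie w c = m *: c]].
Proof.
move=> lDm lMm lm /isom_L3_basis[u1 [u2 [u3 [-> ind [l12 l31 l32]]]]].
(* Eliminating a and m leaves identities in l alone, within reach of [ring]. *)
have aE : a = - (l * m) by rewrite lMm opprK.
have mE : m = 1 - l by rewrite -lDm addrC addKr.
exists (u2 - m *: u1), (u2 - l *: u1), u3; split; last split.
- exact: eigen_change_span.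
- exact: eigen_change_independent.
- rewrite -!scaleNr !(lieDl, lieDr, lieZl, lieZr) !lievv (lieN u2) l12 oppr0.
  by rewrite !scaler0 !addr0.
- rewrite -!scaleNr lieDr lieZr l31 l32 aE mE.
  by apply/matrixP => i j; rewrite !mxE; ring.
- rewrite -!scaleNr lieDr lieZr l31 l32 aE mE.
  by apply/matrixP => i j; rewrite !mxE; ring.
Qed.

Lemma lie_eigenbasis e c w l m x y t x' y' t' :
  lie e c = 0 -> lie w e = l *: e -> lie w c = m *: c ->
  lie (x *: e + y *: c + t *: w) (x' *: e + y' *: c + t' *: w) =
  (l * (t * x' - x * t')) *: e + (m * (t * y' - y * t')) *: c.
Proof.
move=> ec we wc; rewrite !(lieDl, lieDr, lieZl, lieZr) !lievv.
rewrite (lieN c e) (lieN e w) (lieN c w) ec we wc.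
by apply/matrixP => i j; rewrite !mxE; ring.
Qed.

(** Converse of the eigenbasis description. The factor k admits a rescaled w, so that integral
    combinations of h_1 and h_2 can be used directly. *)
Lemma eigenbasis_isom_L3 a k l m e c w :
  l + m = 1 -> l * m = - a -> l != m -> k != 0 -> independent3 e c w ->
  lie e c = 0 -> lie w e = (k * l) *: e -> lie w c = (k * m) *: c ->
  isom_L3 a <<[:: e; c; w]>>%VS.
Proof.
move=> lDm lMm lm k0 ind ec we wc.
have lm0 : l - m != 0 by rewrite subr_eq0.
(* The morphism sends z_1 to e + c, z_2 to l e + m c and z_3 to w / k; it respects [z_3, z_2]
   because l and m are roots of t^2 = t + a. *)
pose g (v : 'rV[C]_3) : M4 := (v 0 (inord 0) + l * v 0 (inord 1)) *: e +
  (v 0 (inord 0) + m * v 0 (inord 1)) *: c + (k^-1 * v 0 (inord 2)) *: w.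
have g_lin : linear g.
  by move=> t u v; apply/matrixP => i j; rewrite !mxE; ring.
pose gL := GRing.isLinear.Build C 'rV[C]_3 M4 *:%R g g_lin.
pose G : {linear 'rV[C]_3 -> M4} := HB.pack g gL.
have fE v : linfun G v = g v by rewrite lfunE.
exists (linfun G); split.
- apply/eqP/lker0P => u v; rewrite !fE => /eqP; rewrite -subr_eq0 => /eqP guv.
  have : g (u - v) = 0.
    by rewrite -[RHS]guv; apply/matrixP => i j; rewrite !mxE; ring.
  case/ind; set d := u - v => e1 e2 /eqP.
  rewrite mulf_eq0 invr_eq0 (negPf k0) => /eqP d2.
  have /eqP : (l - m) * d 0 (inord 1) = 0.
    by rewrite -[RHS](subrr 0) -{1}e1 -e2; ring.
  rewrite mulf_eq0 (negPf lm0) => /eqP d1.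
  move: e1; rewrite d1 mulr0 addr0 => d0.
  apply/eqP; rewrite -subr_eq0 -/d; apply/eqP/rowP => -[[|[|[|//]]] lti];
    rewrite [RHS]mxE; [rewrite -[RHS]d0|rewrite -[RHS]d1|rewrite -[RHS]d2];
    by congr (d _ _); apply/val_inj; rewrite /= inordK.
- apply/vspaceP => X; apply/idP/idP.
    case/memv_imgP=> v _ ->; rewrite fE; apply/memv_span3.
    by do 3!eexists.
  case/memv_span3=> x [y [t ->]]; apply/memv_imgP.
  (* Preimage found by solving v_1 + l v_2 = x, v_1 + m v_2 = y and v_3 / k = t. *)
  exists (\row_i [:: (l * y - m * x) / (l - m); (x - y) / (l - m); k * t]`_i).
    exact: memvf.
  rewrite fE /g !mxE !inordK //=; congr (_ *: _ + _ *: _ + _ *: _).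
  + by field.
  + by field.
  + by field.
- move=> u v; rewrite !fE (lie_eigenbasis _ _ _ _ _ _ ec we wc) /g.
  have aE : a = - (l * m) by rewrite lMm opprK.
  have mE : m = 1 - l by rewrite -lDm addrC addKr.
  rewrite /L3_bracket !mxE /= -!val_eqE /= !inordK //= aE mE.
  (* A zero multiple of w is added on the right so that the coefficients of e, c and w can be
     compared one by one. *)
  rewrite -[RHS]addr0 -[X in _ = _ + X](scale0r w).
  by congr (_ *: _ + _ *: _ + _ *: _); field.
Qed.

Lemma isom_L3_subalgebra a S : {subset S <= @so4 R} -> isom_L3 a S ->
  subalgebra S.
Proof.
move=> Sso4 [f [_ Sf fM]]; split=> // X Y; rewrite -Sf.
move=> /memv_imgP[u _ ->] /memv_imgP[v _ ->].
by rewrite -fM memv_img ?memvf.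
Qed.

End Lie.

(** * Block diagonal matrices with two 2x2 blocks *)

Section Blocks.
Variable F : fieldType.
Implicit Types (U V : 'M[F]_2) (k a b c : F).

Definition blk U V : 'M[F]_(2 + 2) := block_mx U 0 0 V.

Lemma blk_inj U V U' V' : blk U V = blk U' V' -> U = U' /\ V = V'.
Proof. by case/eq_block_mx. Qed.

Lemma blk_eq0 U V : (blk U V == 0) = (U == 0) && (V == 0).
Proof.
apply/eqP/andP => [|[/eqP-> /eqP->]]; last exact: block_mx0.
by rewrite -[RHS](@block_mx0 F 2 2 2 2) => /blk_inj[-> ->].
Qed.

Lemma blkD U V U' V' : blk U V + blk U' V' = blk (U + U') (V + V').
Proof. by rewrite /blk add_block_mx !addr0. Qed.

Lemma blkZ k U V : k *: blk U V = blk (k *: U) (k *: V).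
Proof. by rewrite /blk scale_block_mx !scaler0. Qed.

Lemma blkM U V U' V' : blk U V *m blk U' V' = blk (U *m U') (V *m V').
Proof. by rewrite /blk mulmx_block !mulmx0 !mul0mx !addr0 !add0r. Qed.

Lemma blk1 : blk 1%:M 1%:M = 1%:M.
Proof. by rewrite /blk -scalar_mx_block. Qed.

Lemma blk_unitmx U V : U \in unitmx -> V \in unitmx -> blk U V \in unitmx.
Proof.
move=> uU uV; apply: (mulmx1_unit (B := blk (invmx U) (invmx V)) _).1.
by rewrite blkM !mulmxV // blk1.
Qed.

Lemma blk_inv U V : U \in unitmx -> V \in unitmx ->
  invmx (blk U V) = blk (invmx U) (invmx V).
Proof.
move=> uU uV; have uB := blk_unitmx uU uV.
rewrite -[LHS]mulmx1; apply: (canLR (mulKmx uB)).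
by rewrite blkM !mulmxV // blk1.
Qed.

(** This is a h_1 + b x_1 + c y_1 + a' h_2 + b' x_2 + c' y_2: in these Chevalley coordinates every
    relation in so(4) becomes six scalar identities. *)
Definition el a b c a' b' c' := blk (sl a b c) (sl a' b' c').

Lemma el_inj a b c a' b' c' p q r p' q' r' :
  el a b c a' b' c' = el p q r p' q' r' ->
  [/\ a = p, b = q & c = r] /\ [/\ a' = p', b' = q' & c' = r'].
Proof. by case/blk_inj=> /sl_inj ? /sl_inj. Qed.

Lemma elD a b c a' b' c' p q r p' q' r' :
  el a b c a' b' c' + el p q r p' q' r' =
  el (a + p) (b + q) (c + r) (a' + p') (b' + q') (c' + r').
Proof. by rewrite /el blkD !slD. Qed.

Lemma elZ k a b c a' b' c' : k *: el a b c a' b' c' =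
  el (k * a) (k * b) (k * c) (k * a') (k * b') (k * c').
Proof. by rewrite /el blkZ !slZ. Qed.

Lemma el0 : el 0 0 0 0 0 0 = 0.
Proof. by rewrite /el !sl0 /blk block_mx0. Qed.

End Blocks.

(** * The algebra so(4) and its inner automorphisms, blockwise *)

Section So4.
Variable R : realType.
Local Notation C := R[i].
Local Notation M4 := 'M[C]_(2 + 2).
Implicit Types (X Y : M4) (S : {vspace M4}) (U V P Q : 'M[C]_2) (a b c : C).

Lemma delta_ulblock (i j : 'I_2) :
  delta_mx (lshift 2 i) (lshift 2 j) = blk (delta_mx i j) 0 :> M4.
Proof.
apply/matrixP => r s; rewrite -[r]splitK -[s]splitK.
case: (split r) => r'; case: (split s) => s';
  by rewrite ?block_mxEul ?block_mxEur ?block_mxEdl ?block_mxEdr !mxE /=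
    ?eq_lshift ?eq_rshift ?eq_lrshift ?eq_rlshift ?andbF.
Qed.

Lemma delta_drblock (i j : 'I_2) :
  delta_mx (rshift 2 i) (rshift 2 j) = blk 0 (delta_mx i j) :> M4.
Proof.
apply/matrixP => r s; rewrite -[r]splitK -[s]splitK.
case: (split r) => r'; case: (split s) => s';
  by rewrite ?block_mxEul ?block_mxEur ?block_mxEdl ?block_mxEdr !mxE /=
    ?eq_lshift ?eq_rshift ?eq_lrshift ?eq_rlshift ?andbF.
Qed.

Lemma x1E : x1 R = el 0 1 0 0 0 0.
Proof.
rewrite /x1 /E /el sl0 -[RHS]/(blk _ 0).
have -> : inord 0 = lshift 2 0 :> 'I_(2 + 2)
  by apply/val_inj; rewrite /= inordK.
have -> : inord 1 = lshift 2 1 :> 'I_(2 + 2)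
  by apply/val_inj; rewrite /= inordK.
by rewrite delta_ulblock; congr blk; apply: mx2_eq; rewrite !mxE /= ?oppr0.
Qed.

Lemma x2E : x2 R = el 0 0 0 0 1 0.
Proof.
rewrite /x2 /E /el sl0 -[RHS]/(blk 0 _).
have -> : inord 2 = rshift 2 0 :> 'I_(2 + 2)
  by apply/val_inj; rewrite /= inordK.
have -> : inord 3 = rshift 2 1 :> 'I_(2 + 2)
  by apply/val_inj; rewrite /= inordK.
by rewrite delta_drblock; congr blk; apply: mx2_eq; rewrite !mxE /= ?oppr0.
Qed.

Lemma h1E : h1 R = el 1 0 0 0 0 0.
Proof.
rewrite /h1 /E /el sl0 -[RHS]/(blk _ 0).
have -> : inord 0 = lshift 2 0 :> 'I_(2 + 2)
  by apply/val_inj; rewrite /= inordK.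
have -> : inord 1 = lshift 2 1 :> 'I_(2 + 2)
  by apply/val_inj; rewrite /= inordK.
rewrite !delta_ulblock -scaleN1r blkZ blkD scaler0 addr0.
by congr blk; apply: mx2_eq; rewrite !mxE /= ?mulr0 ?mulr1 ?addr0 ?add0r ?oppr0.
Qed.

Lemma h2E : h2 R = el 0 0 0 1 0 0.
Proof.
rewrite /h2 /E /el sl0 -[RHS]/(blk 0 _).
have -> : inord 2 = rshift 2 0 :> 'I_(2 + 2)
  by apply/val_inj; rewrite /= inordK.
have -> : inord 3 = rshift 2 1 :> 'I_(2 + 2)
  by apply/val_inj; rewrite /= inordK.
rewrite !delta_drblock -scaleN1r blkZ blkD scaler0 addr0.
by congr blk; apply: mx2_eq; rewrite !mxE /= ?mulr0 ?mulr1 ?addr0 ?add0r ?oppr0.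
Qed.

Lemma so4P X : X \in @so4 R <->
  exists U V, [/\ \tr U = 0, \tr V = 0 & X = blk U V].
Proof.
split.
  rewrite inE => /and4P[/eqP ur /eqP dl /eqP tu /eqP td].
  exists (ulsubmx X), (drsubmx X); split=> //.
  by rewrite -{1}(submxK X) ur dl.
case=> U [V [tU tV ->]].
rewrite inE /blk block_mxKur block_mxKdl block_mxKul block_mxKdr.
by rewrite tU tV !eqxx.
Qed.

Lemma el_so4 a b c a' b' c' : el a b c a' b' c' \in @so4 R.
Proof.
by apply/so4P; do 2!eexists; split; last reflexivity; exact: trace_sl.
Qed.

Lemma span3_so4 X Y Z : X \in @so4 R -> Y \in @so4 R -> Z \in @so4 R ->
  {subset <<[:: X; Y; Z]>>%VS <= @so4 R}.
Proof.
move=> /so4P[U [V [tU tV ->]]] /so4P[U' [V' [tU' tV' ->]]].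
move=> /so4P[U'' [V'' [tU'' tV'' ->]]] T /memv_span3[a [b [c ->]]].
rewrite !blkZ !blkD; apply/so4P; do 2!eexists; split; last reflexivity.
  by rewrite !linearD !linearZ /= tU tU' tU'' !mulr0 !addr0.
by rewrite !linearD !linearZ /= tV tV' tV'' !mulr0 !addr0.
Qed.

Lemma lie_blk U V U' V' : lie (blk U V) (blk U' V') = blk (br U U') (br V V').
Proof. by rewrite /lie !blkM -scaleN1r blkZ blkD !scaleN1r. Qed.

Lemma lie_el a b c a' b' c' p q r p' q' r' :
  lie (el a b c a' b' c') (el p q r p' q' r') =
  el (b * r - q * c) (2 * (a * q - p * b)) (2 * (c * p - r * a))
     (b' * r' - q' * c') (2 * (a' * q' - p' * b')) (2 * (c' * p' - r' * a')).
Proof. by rewrite lie_blk !br_sl. Qed.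

Lemma inner_aut_blk P Q U V : P \in unitmx -> Q \in unitmx ->
  inner_aut (blk P Q) (blk U V) = blk (P *m U *m invmx P) (Q *m V *m invmx Q).
Proof. by move=> uP uQ; rewrite inner_autE blk_inv // !blkM. Qed.

(** Generators are matched one by one, with the intertwining relations in the form in which the
    normal forms provide them. *)
Lemma equivalent_span3 P Q U1 V1 U2 V2 U3 V3 U1' V1' U2' V2' U3' V3' :
  \det P = 1 -> \det Q = 1 ->
  P *m U1 = U1' *m P -> P *m U2 = U2' *m P -> P *m U3 = U3' *m P ->
  Q *m V1 = V1' *m Q -> Q *m V2 = V2' *m Q -> Q *m V3 = V3' *m Q ->
  equivalent <<[:: blk U1 V1; blk U2 V2; blk U3 V3]>>%VS
             <<[:: blk U1' V1'; blk U2' V2'; blk U3' V3']>>%VS.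
Proof.
move=> dP dQ p1 p2 p3 q1 q2 q3.
have uP := det1_unitmx dP; have uQ := det1_unitmx dQ.
exists (blk P Q); first by exists P, Q.
by rewrite limg_span /= !inner_aut_blk ?(conj_eqP uP p1, conj_eqP uP p2,
  conj_eqP uP p3, conj_eqP uQ q1, conj_eqP uQ q2, conj_eqP uQ q3).
Qed.

Lemma equivalent_sym S S' : equivalent S S' -> equivalent S' S.
Proof.
case=> A [P [Q [dP dQ]]]; rewrite -/(blk P Q) => AE <-.
have uP := det1_unitmx dP; have uQ := det1_unitmx dQ.
have uA : A \in unitmx by rewrite AE blk_unitmx.
exists (blk (invmx P) (invmx Q)).
  by exists (invmx P), (invmx Q); rewrite !det_inv dP dQ !invr1.
rewrite -blk_inv // -AE -limg_comp.
have -> : (inner_aut (invmx A) \o inner_aut A)%VF = \1%VF.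
  apply/lfunP => X; rewrite comp_lfunE !inner_autE lfunE /= invmxK.
  by rewrite !mulmxA mulVmx // mul1mx mulmxKV.
by rewrite lim1g.
Qed.

(** This is the form used to refute equivalence: an element of S is transported blockwise, and only
    the invertibility of P and Q is retained. *)
Lemma equivalent_mem S S' : equivalent S S' -> exists P Q,
  [/\ P \in unitmx, Q \in unitmx & forall U V, blk U V \in S ->
      blk (P *m U *m invmx P) (Q *m V *m invmx Q) \in S'].
Proof.
case=> A [P [Q [dP dQ]]]; rewrite -/(blk P Q) => AE <-.
have uP := det1_unitmx dP; have uQ := det1_unitmx dQ.
exists P, Q; split=> // U V UVS.
by rewrite -inner_aut_blk // AE memv_img.
Qed.

End So4.

(** * Eigenbases inside so(4), and the exclusion of a = -1/4 *)

Section Classification.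
Variable R : realType.
Local Notation C := R[i].
Local Notation M4 := 'M[C]_(2 + 2).
Implicit Types (S : {vspace M4}) (U V W P Q : 'M[C]_2) (a s l m : C).

(** The relations hold in each factor separately because brackets are computed blockwise. Of linear
    independence only e <> 0 and c <> 0 are kept, which suffices for the classification. *)
Lemma so4_eigenbasis a l m S : l + m = 1 -> l * m = - a -> l != m ->
  subalgebra S -> isom_L3 a S -> exists e1 e2 c1 c2 w1 w2 : 'M[C]_2,
  [/\ S = <<[:: blk e1 e2; blk c1 c2; blk w1 w2]>>%VS,
      [/\ \tr e1 = 0, \tr e2 = 0, \tr c1 = 0 & \tr c2 = 0]
      /\ \tr w1 = 0 /\ \tr w2 = 0,
      ~~ ((e1 == 0) && (e2 == 0)) /\ ~~ ((c1 == 0) && (c2 == 0)),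
      [/\ br e1 c1 = 0, br w1 e1 = l *: e1 & br w1 c1 = m *: c1]
    & [/\ br e2 c2 = 0, br w2 e2 = l *: e2 & br w2 c2 = m *: c2]].
Proof.
move=> lDm lMm lm [Sso4 _] /(isom_L3_eigenbasis lDm lMm lm).
case=> e [c [w [SE ind [ec we wc]]]].
have in_so4 X : X \in [:: e; c; w] -> X \in @so4 R.
  by move=> /memv_span; rewrite -SE => /Sso4.
have e0 : e != 0.
  apply/eqP => e0; have [|/eqP] := ind 1 0 0; last by rewrite oner_eq0.
  by rewrite e0 !scale0r scaler0 !addr0.
have c0 : c != 0.
  apply/eqP => c0; have [|_ /eqP] := ind 0 1 0; last by rewrite oner_eq0.
  by rewrite c0 !scale0r scaler0 !addr0.
have /so4P[e1 [e2 [te1 te2 eE]]] := in_so4 e ltac:(by rewrite !inE eqxx).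
have /so4P[c1 [c2 [tc1 tc2 cE]]] := in_so4 c ltac:(by rewrite !inE eqxx orbT).
have /so4P[w1 [w2 [tw1 tw2 wE]]] := in_so4 w ltac:(by rewrite !inE eqxx !orbT).
move: ec we wc e0 c0 SE; rewrite eE cE wE !lie_blk !blkZ !blk_eq0.
move=> /eqP; rewrite blk_eq0 => /andP[/eqP ec1 /eqP ec2].
move=> /blk_inj[we1 we2] /blk_inj[wc1 wc2] e0 c0 SE.
exists e1, e2, c1, c2, w1, w2.
by split; [exact: SE|split; split|split|split|split].
Qed.

(** For a = -1/4 the polynomial t^2 - t - a has the double root 1/2, and u1, v form a Jordan block
    of ad u3 there. In each factor [br_no_jordan] kills the component of v, so v = 0, against the
    independence of u1 and u2. *)
Lemma no_L3_quarter S : ~ (subalgebra S /\ isom_L3 (- (1 / 4)) S).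
Proof.
case=> [[Sso4 _] /isom_L3_basis[u1 [u2 [u3 [SE ind [_ l31 l32]]]]]].
have two0 : 2 != 0 :> C by rewrite pnatr_eq0.
have half0 : 2^-1 != 0 :> C by rewrite invr_eq0.
have in_so4 X : X \in [:: u1; u2; u3] -> X \in @so4 R.
  by move=> /memv_span; rewrite -SE => /Sso4.
pose v := u2 - 2^-1 *: u1.
have /so4P[p1 [p2 [tp1 tp2 pE]]] := in_so4 u1 ltac:(by rewrite !inE eqxx).
have /so4P[q1 [q2 [tq1 tq2 qE]]] := in_so4 u2 ltac:(by rewrite !inE eqxx orbT).
have /so4P[w1 [w2 [tw1 tw2 wE]]] := in_so4 u3 ltac:(by rewrite !inE eqxx !orbT).
pose r1 := q1 - 2^-1 *: p1; pose r2 := q2 - 2^-1 *: p2.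
have vE : v = blk r1 r2.
  by rewrite /v pE qE -scaleNr blkZ blkD !scaleNr.
have tr1 : \tr r1 = 0 by rewrite /r1 linearB linearZ /= tp1 tq1 mulr0 subrr.
have tr2 : \tr r2 = 0 by rewrite /r2 linearB linearZ /= tp2 tq2 mulr0 subrr.
have : lie u3 u1 = 2^-1 *: u1 + v by rewrite l31 /v addrC subrK.
have : lie u3 v = 2^-1 *: v.
  rewrite /v -scaleNr lieDr lieZr l31 l32.
  by apply/matrixP => i j; rewrite !mxE; field.
rewrite vE pE wE !lie_blk !blkZ !blkD => /blk_inj[v1 v2] /blk_inj[u1E u2E].
have r10 := br_no_jordan two0 tw1 tp1 tr1 half0 u1E v1.
have r20 := br_no_jordan two0 tw2 tp2 tr2 half0 u2E v2.
have [] := ind (- 2^-1) 1 0; last by move=> _ /eqP; rewrite oner_eq0.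
rewrite scale0r scale1r addr0 addrC scaleNr -/v vE r10 r20.
by apply/eqP; rewrite blk_eq0 !eqxx.
Qed.

(** * The case of a outside 0 and -1/4: a square root s of 1 + 4a gives one listed algebra, - s the
    other *)

Definition L3s s : {vspace M4} :=
  <<[:: x1 R; x2 R; ((1 + s) *: h1 R + (1 - s) *: h2 R)%R]>>%VS.

Lemma L3s_el s : L3s s =
  <<[:: el 0 1 0 0 0 0; el 0 0 0 0 1 0; el (1 + s) 0 0 (1 - s) 0 0]>>%VS.
Proof.
rewrite /L3s x1E x2E h1E h2E !elZ elD.
by rewrite !(mulr0, mulr1, addr0, add0r).
Qed.

Lemma L3s_isom a s : s ^+ 2 = 1 + 4 * a -> s != 0 -> isom_L3 a (L3s s).
Proof.
move=> sE s0; have two0 : 2 != 0 :> C by rewrite pnatr_eq0.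
have aE : a = (s ^+ 2 - 1) / 4 by rewrite sE; field.
(* The third generator acts on x_1 and x_2 by 2 (1 + s) and 2 (1 - s), that is, by 4 times the roots
   (1 + s) / 2 and (1 - s) / 2. *)
rewrite L3s_el; apply: (@eigenbasis_isom_L3 _ _ 4 ((1 + s) / 2) ((1 - s) / 2)).
- by field.
- by rewrite aE; field.
- rewrite -subr_eq0 (_ : _ - _ = s) //; by field.
- by rewrite pnatr_eq0.
- move=> x y t; rewrite !elZ !elD -el0 => /el_inj.
  rewrite !(mulr0, mulr1, addr0, add0r) => -[[e1 -> _] [e2 -> _]]; split=> //.
  by apply: (mulfI two0); rewrite mulr0 -[RHS](addr0 0) -{1}e1 -e2; ring.
- by rewrite lie_el -el0; congr el; ring.
- by rewrite lie_el elZ; congr el; field.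
- by rewrite lie_el elZ; congr el; field.
Qed.

Lemma L3s_so4 s : {subset L3s s <= @so4 R}.
Proof. by rewrite L3s_el; apply: span3_so4; apply: el_so4. Qed.

(** An equivalence carries x_1 and x_2 to multiples of themselves, and the third generator to t
    times the new one plus nilpotent terms. Comparing eigenvalues gives t (1 - s) = 1 + s and t (1 +
    s) = 1 - s; the sum yields t = 1, hence s = 0. *)
Lemma L3s_not_equivalent s : s != 0 -> s ^+ 2 != 1 ->
  ~ equivalent (L3s s) (L3s (- s)).
Proof.
move=> s0 s1 /equivalent_mem[P [Q [uP uQ PQ]]].
have two0 : 2 != 0 :> C by rewrite pnatr_eq0.
have mem U V : blk U V \in L3s s -> exists x y t,
    P *m U *m invmx P = sl (t * (1 - s)) x 0 /\
    Q *m V *m invmx Q = sl (t * (1 + s)) y 0.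
  move=> /PQ; rewrite L3s_el => /memv_span3[x [y [t]]].
  rewrite !elZ !elD /el => /blk_inj[-> ->]; exists x, y, t.
  by split; congr sl; ring.
pose x := sl 0 1 0 : 'M[C]_2.
have x0 : x != 0.
  by rewrite -sl0; apply/eqP => /sl_inj[_ /eqP]; rewrite oner_eq0.
have [p [q [t [Pw Qw]]]] : exists p q t,
    P *m sl (1 + s) 0 0 *m invmx P = sl (t * (1 - s)) p 0 /\
    Q *m sl (1 - s) 0 0 *m invmx Q = sl (t * (1 + s)) q 0.
  apply: mem; rewrite L3s_el; apply/memv_span3.
  by exists 0, 0, 1; rewrite !scale0r !add0r scale1r.
have [p1 [q1 [t1 [Px Q0]]]] : exists p q t,
    P *m x *m invmx P = sl (t * (1 - s)) p 0 /\
    Q *m 0 *m invmx Q = sl (t * (1 + s)) q 0.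
  apply: mem; rewrite L3s_el; apply/memv_span3.
  by exists 1, 0, 0; rewrite !scale0r !addr0 scale1r /el sl0.
have [p2 [q2 [t2 [P0 Qx]]]] : exists p q t,
    P *m 0 *m invmx P = sl (t * (1 - s)) p 0 /\
    Q *m x *m invmx Q = sl (t * (1 + s)) q 0.
  apply: mem; rewrite L3s_el; apply/memv_span3.
  by exists 0, 1, 0; rewrite !scale0r !addr0 add0r scale1r /el sl0.
have sp0 : 1 + s != 0.
  apply: contraNneq s1 => e; rewrite -subr_eq0 -(mulr0 (s - 1)) -e.
  by apply/eqP; ring.
have sm0 : 1 - s != 0.
  apply: contraNneq s1 => e; rewrite -subr_eq0 -(mulr0 (- s - 1)) -e.
  by apply/eqP; ring.
(* The zero block stays zero under conjugation, so t1 (1 + s) = 0; hence the image of x in the other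
   block has no diagonal part. *)
have t10 : t1 = 0.
  move: Q0; rewrite mulmx0 mul0mx -sl0 => /esym/sl_inj[/eqP + _ _].
  by rewrite mulf_eq0 (negPf sp0) orbF => /eqP.
have t20 : t2 = 0.
  move: P0; rewrite mulmx0 mul0mx -sl0 => /esym/sl_inj[/eqP + _ _].
  by rewrite mulf_eq0 (negPf sm0) orbF => /eqP.
rewrite t10 mul0r in Px; rewrite t20 mul0r in Qx.
have p10 : p1 != 0.
  apply: contraNneq x0 => p10; rewrite -(conj_eq0 _ uP) Px p10 sl0 //.
have q20 : q2 != 0.
  apply: contraNneq x0 => q20; rewrite -(conj_eq0 _ uQ) Qx q20 sl0 //.
have wx k : br (sl k 0 0) x = (2 * k) *: x.
  by rewrite /x br_sl slZ; congr sl; ring.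
(* The relation [h, x] = 2 x is transported by conjugation in each block. *)
have := br_conj (sl (1 + s) 0 0) x uP.
rewrite wx -scalemxAr -scalemxAl Pw Px br_sl slZ => /sl_inj[_ eP _].
have := br_conj (sl (1 - s) 0 0) x uQ.
rewrite wx -scalemxAr -scalemxAl Qw Qx br_sl slZ => /sl_inj[_ eQ _].
have {}eP : t * (1 - s) = 1 + s.
  by apply: (mulfI two0); apply: (mulIf p10); rewrite -eP; ring.
have {}eQ : t * (1 + s) = 1 - s.
  by apply: (mulfI two0); apply: (mulIf q20); rewrite -eQ; ring.
have t1E : t = 1.
  apply: (mulfI two0); transitivity (t * (1 - s) + t * (1 + s)); first by ring.
  by rewrite eP eQ; ring.
case/eqP: s0; apply: (mulfI two0); rewrite mulr0.
by rewrite -(subrr (1 + s)) -{2}eP t1E; ring.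
Qed.

(** P and Q normalize the two Borel pairs independently. The corner entries p and q are removed by
    x_1 and x_2, which lie in the span, and the factor 4 clears the denominators of the diagonal. *)
Lemma L3s_normal_form s U V W1 W2 : 1 + s != 0 -> 1 - s != 0 ->
  \tr U = 0 -> \tr V = 0 -> \tr W1 = 0 -> \tr W2 = 0 -> U != 0 -> V != 0 ->
  br W1 U = ((1 + s) / 2) *: U -> br W2 V = ((1 - s) / 2) *: V ->
  equivalent <<[:: blk U 0; blk 0 V; blk W1 W2]>>%VS (L3s s).
Proof.
move=> sp0 sm0 tU tV tW1 tW2 U0 V0 eU eV.
have two0 : 2 != 0 :> C by rewrite pnatr_eq0.
have l0 : (1 + s) / 2 != 0 by rewrite mulf_neq0 ?invr_eq0.
have m0 : (1 - s) / 2 != 0 by rewrite mulf_neq0 ?invr_eq0.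
have [P [p [dP PU PW]]] := borel_normal_form tW1 tU l0 U0 eU.
have [Q [q [dQ QV QW]]] := borel_normal_form tW2 tV m0 V0 eV.
have -> : L3s s = <<[:: blk (sl 0 1 0) 0; blk 0 (sl 0 1 0);
    blk (sl ((1 + s) / 2 / 2) p 0) (sl ((1 - s) / 2 / 2) q 0)]>>%VS.
  rewrite L3s_el -sl0 -!/(el _ _ _ _ _ _).
  apply: span3_eq; apply/memv_span3.
  - by exists 1, 0, 0; rewrite !elZ !elD; congr el; ring.
  - by exists 0, 1, 0; rewrite !elZ !elD; congr el; ring.
  - by exists (- 4 * p), (- 4 * q), 4; rewrite !elZ !elD; congr el; field.
  - by exists 1, 0, 0; rewrite !elZ !elD; congr el; ring.
  - by exists 0, 1, 0; rewrite !elZ !elD; congr el; ring.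
  - by exists p, q, 4^-1; rewrite !elZ !elD; congr el; field.
by apply: (equivalent_span3 dP dQ PU _ PW _ QV QW); rewrite mulmx0 mul0mx.
Qed.

Lemma L3s_classification a s S : s ^+ 2 = 1 + 4 * a -> s != 0 -> a != 0 ->
  subalgebra S -> isom_L3 a S ->
  equivalent S (L3s s) \/ equivalent S (L3s (- s)).
Proof.
move=> sE s0 a0 subS isoS.
have two0 : 2 != 0 :> C by rewrite pnatr_eq0.
have aE : a = (s ^+ 2 - 1) / 4 by rewrite sE; field.
have sp0 : 1 + s != 0.
  apply: contraNneq a0 => e; rewrite aE -(mulr0 ((s - 1) / 4)) -e.
  by apply/eqP; field.
have sm0 : 1 - s != 0.
  apply: contraNneq a0 => e; rewrite aE -(mulr0 ((- s - 1) / 4)) -e.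
  by apply/eqP; field.
pose l := (1 + s) / 2; pose m := (1 - s) / 2.
have lDm : l + m = 1 by rewrite /l /m; field.
have lMm : l * m = - a by rewrite /l /m aE; field.
have lm : l != m by rewrite -subr_eq0 (_ : l - m = s) // /l /m; field.
have l0 : l != 0 by rewrite mulf_neq0 ?invr_eq0.
have m0 : m != 0 by rewrite mulf_neq0 ?invr_eq0.
have lDm0 : l + m != 0 by rewrite lDm oner_eq0.
have [e1 [e2 [c1 [c2 [w1 [w2 [SE [[te1 te2 tc1 tc2] [tw1 tw2]]]]]]]]] :=
  so4_eigenbasis lDm lMm lm subS isoS.
move=> [e0 c0] [_ we1 wc1] [_ we2 wc2].
have := br_eigenvalues_dependent tw1 te1 tc1 l0 m0 lm lDm0 we1 wc1.
have := br_eigenvalues_dependent tw2 te2 tc2 l0 m0 lm lDm0 we2 wc2.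
(* Since e and c are nonzero, they survive in different factors. *)
move=> [e20|c20] [e10|c10].
- by rewrite e10 e20 !eqxx in e0.
- left; move: e0 c0; rewrite SE e20 c10 !eqxx andbT /= => e10 c20.
  exact: L3s_normal_form.
(* Now c occupies the first factor; exchanging e and c exchanges the two roots, which amounts to
   replacing s by - s. *)
- right; move: e0 c0; rewrite SE e10 c20 span3_swap !eqxx andbT /= => e20 c10.
  by apply: L3s_normal_form; rewrite ?opprK.
- by rewrite c10 c20 !eqxx in c0.
Qed.

(** * The case a = 0: the four listed algebras and the normal forms *)

Lemma L301_el : @L301 R =
  <<[:: el 1 0 0 0 0 0; el 0 0 0 0 1 0; el 0 0 0 1 0 0]>>%VS.
Proof. by rewrite /L301 h1E x2E h2E. Qed.

Lemma L302_el : @L302 R =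
  <<[:: el 0 1 0 0 0 0; el 0 0 0 0 1 0; el 0 0 0 1 0 0]>>%VS.
Proof. by rewrite /L302 x1E x2E h2E. Qed.

Lemma L303_el : @L303 R =
  <<[:: el 0 1 0 0 0 0; el 1 0 0 0 0 0; el 0 0 0 1 0 0]>>%VS.
Proof. by rewrite /L303 x1E h1E h2E. Qed.

Lemma L304_el : @L304 R =
  <<[:: el 0 1 0 0 0 0; el 1 0 0 0 0 0; el 0 0 0 0 1 0]>>%VS.
Proof. by rewrite /L304 x1E h1E x2E. Qed.

Definition L30 : seq {vspace M4} := [:: L301; L302; L303; L304].

Lemma L30_so4 L : L \in L30 -> {subset L <= @so4 R}.
Proof.
rewrite !inE => /or4P[] /eqP ->; rewrite ?L301_el ?L302_el ?L303_el ?L304_el;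
  by apply: span3_so4; apply: el_so4.
Qed.

(** For a = 0 the roots are l = 1 and m = 0, and k = 2 accounts for [h, x] = 2 x. *)
Lemma isom_L3_0 (e c w : M4) : independent3 e c w ->
  lie e c = 0 -> lie w e = 2 *: e -> lie w c = 0 ->
  isom_L3 0 <<[:: e; c; w]>>%VS.
Proof.
move=> ind ec we wc; apply: (@eigenbasis_isom_L3 _ _ 2 1 0) => //.
- by rewrite addr0.
- by rewrite mulr0 oppr0.
- by rewrite oner_eq0.
- by rewrite pnatr_eq0.
- by rewrite mulr1.
- by rewrite mulr0 scale0r.
Qed.

(** The triples (e, c, w) are (x_2, h_1, h_2), (x_2, x_1, h_2), (x_1, h_2, h_1) and (x_1, x_2, h_1),
    in the order of the list. *)
Lemma L30_isom L : L \in L30 -> isom_L3 0 L.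
Proof.
rewrite !inE => /or4P[] /eqP ->; rewrite ?L301_el ?L302_el ?L303_el ?L304_el.
- rewrite span3_swap; apply: isom_L3_0.
  + move=> x y t; rewrite !elZ !elD -el0 => /el_inj.
    by rewrite !(mulr0, mulr1, addr0, add0r) => -[[-> _ _] [-> -> _]].
  + by rewrite lie_el -el0; congr el; ring.
  + by rewrite lie_el elZ; congr el; ring.
  + by rewrite lie_el -el0; congr el; ring.
- rewrite span3_swap; apply: isom_L3_0.
  + move=> x y t; rewrite !elZ !elD -el0 => /el_inj.
    by rewrite !(mulr0, mulr1, addr0, add0r) => -[[_ -> _] [-> -> _]].
  + by rewrite lie_el -el0; congr el; ring.
  + by rewrite lie_el elZ; congr el; ring.
  + by rewrite lie_el -el0; congr el; ring.
- rewrite span3_swapr; apply: isom_L3_0.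
  + move=> x y t; rewrite !elZ !elD -el0 => /el_inj.
    by rewrite !(mulr0, mulr1, addr0, add0r) => -[[-> -> _] [-> _ _]].
  + by rewrite lie_el -el0; congr el; ring.
  + by rewrite lie_el elZ; congr el; ring.
  + by rewrite lie_el -el0; congr el; ring.
- rewrite span3_swapr; apply: isom_L3_0.
  + move=> x y t; rewrite !elZ !elD -el0 => /el_inj.
    by rewrite !(mulr0, mulr1, addr0, add0r) => -[[-> -> _] [_ -> _]].
  + by rewrite lie_el -el0; congr el; ring.
  + by rewrite lie_el elZ; congr el; ring.
  + by rewrite lie_el -el0; congr el; ring.
Qed.

(** Here the central element c lies in the first factor. As W1 commutes with U, it is a multiple of
    U and can be removed within the span; what remains is a Borel pair in the second factor and the
    conjugacy class of U up to scaling. *)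
Lemma L30_normal_forml (U V W1 W2 : 'M[C]_2) :
  \tr U = 0 -> \tr V = 0 -> \tr W1 = 0 -> \tr W2 = 0 -> U != 0 -> V != 0 ->
  br W1 U = 0 -> br W2 V = V ->
  exists2 L, L \in L30 & equivalent <<[:: blk 0 V; blk U 0; blk W1 W2]>>%VS L.
Proof.
move=> tU tV tW1 tW2 U0 V0 W1U W2V.
have two0 : 2 != 0 :> C by rewrite pnatr_eq0.
have [k ->] := commuting_multiple tW1 tU U0 W1U.
rewrite -[V in RHS]scale1r in W2V.
have [Q [q [dQ QV QW]]] := borel_normal_form tW2 tV (oner_neq0 _) V0 W2V.
(* A nilpotent U becomes x_1, which gives [L302]; otherwise U becomes a nonzero multiple of h_1,
   which gives [L301]. *)
have [/eqP dU|dU] := boolP (\det U == 0).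
  have [P dP PU] := nilpotent_normal_form tU dU U0.
  exists L302; first by rewrite !inE eqxx !orbT.
  have -> : L302 = <<[:: blk 0 (sl 0 1 0); blk (sl 0 1 0) 0;
      blk (k *: sl 0 1 0) (sl (1 / 2) q 0)]>>%VS :> {vspace M4}.
    rewrite L302_el -sl0 slZ -!/(el _ _ _ _ _ _).
    apply: span3_eq; apply/memv_span3.
    - by exists 0, 1, 0; rewrite !elZ !elD; congr el; ring.
    - by exists 1, 0, 0; rewrite !elZ !elD; congr el; ring.
    (* The coefficient 2 turns the diagonal entry 1 / 2 into 1, and the other two cancel the terms
       in q and k. *)
    - by exists (- 2 * q), (- 2 * k), 2; rewrite !elZ !elD; congr el; field.
    - by exists 0, 1, 0; rewrite !elZ !elD; congr el; ring.
    - by exists 1, 0, 0; rewrite !elZ !elD; congr el; ring.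
    - by exists k, q, 2^-1; rewrite !elZ !elD; congr el; field.
  apply: (equivalent_span3 dP dQ _ PU _ QV _ QW); try by rewrite mulmx0 mul0mx.
  by rewrite -scalemxAr PU scalemxAl.
have [P [m [dP m0 PU]]] := semisimple_normal_form tU dU.
exists L301; first by rewrite !inE eqxx.
have -> : L301 = <<[:: blk 0 (sl 0 1 0); blk (sl m 0 0) 0;
    blk (k *: sl m 0 0) (sl (1 / 2) q 0)]>>%VS :> {vspace M4}.
  rewrite L301_el -sl0 slZ -!/(el _ _ _ _ _ _).
  apply: span3_eq; apply/memv_span3.
  - by exists 0, m^-1, 0; rewrite !elZ !elD; congr el; field.
  - by exists 1, 0, 0; rewrite !elZ !elD; congr el; ring.
  - by exists (- 2 * q), (- 2 * k), 2; rewrite !elZ !elD; congr el; field.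
  - by exists 0, 1, 0; rewrite !elZ !elD; congr el; ring.
  - by exists m, 0, 0; rewrite !elZ !elD; congr el; ring.
  - by exists (k * m), q, 2^-1; rewrite !elZ !elD; congr el; field.
apply: (equivalent_span3 dP dQ _ PU _ QV _ QW); try by rewrite mulmx0 mul0mx.
by rewrite -scalemxAr PU scalemxAl.
Qed.

(** Mirror image, with c in the second factor: a nilpotent V leads to [L304], a semisimple one to
    [L303]. *)
Lemma L30_normal_formr (U V W1 W2 : 'M[C]_2) :
  \tr U = 0 -> \tr V = 0 -> \tr W1 = 0 -> \tr W2 = 0 -> U != 0 -> V != 0 ->
  br W1 U = U -> br W2 V = 0 ->
  exists2 L, L \in L30 & equivalent <<[:: blk U 0; blk 0 V; blk W1 W2]>>%VS L.
Proof.
move=> tU tV tW1 tW2 U0 V0 W1U W2V.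
have two0 : 2 != 0 :> C by rewrite pnatr_eq0.
have [k ->] := commuting_multiple tW2 tV V0 W2V.
rewrite -[U in RHS]scale1r in W1U.
have [P [p [dP PU PW]]] := borel_normal_form tW1 tU (oner_neq0 _) U0 W1U.
have [/eqP dV|dV] := boolP (\det V == 0).
  have [Q dQ QV] := nilpotent_normal_form tV dV V0.
  exists L304; first by rewrite !inE eqxx !orbT.
  have -> : L304 = <<[:: blk (sl 0 1 0) 0; blk 0 (sl 0 1 0);
      blk (sl (1 / 2) p 0) (k *: sl 0 1 0)]>>%VS :> {vspace M4}.
    rewrite L304_el -sl0 slZ -!/(el _ _ _ _ _ _).
    apply: span3_eq; apply/memv_span3.
    - by exists 1, 0, 0; rewrite !elZ !elD; congr el; ring.
    - by exists (- 2 * p), (- 2 * k), 2; rewrite !elZ !elD; congr el; field.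
    - by exists 0, 1, 0; rewrite !elZ !elD; congr el; ring.
    - by exists 1, 0, 0; rewrite !elZ !elD; congr el; ring.
    - by exists 0, 0, 1; rewrite !elZ !elD; congr el; ring.
    - by exists p, 2^-1, k; rewrite !elZ !elD; congr el; field.
  apply: (equivalent_span3 dP dQ PU _ PW _ QV); try by rewrite mulmx0 mul0mx.
  by rewrite -scalemxAr QV scalemxAl.
have [Q [m [dQ m0 QV]]] := semisimple_normal_form tV dV.
exists L303; first by rewrite !inE eqxx !orbT.
have -> : L303 = <<[:: blk (sl 0 1 0) 0; blk 0 (sl m 0 0);
    blk (sl (1 / 2) p 0) (k *: sl m 0 0)]>>%VS :> {vspace M4}.
  rewrite L303_el -sl0 slZ -!/(el _ _ _ _ _ _).
  apply: span3_eq; apply/memv_span3.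
  - by exists 1, 0, 0; rewrite !elZ !elD; congr el; ring.
  - by exists (- 2 * p), (- 2 * k), 2; rewrite !elZ !elD; congr el; field.
  - by exists 0, m^-1, 0; rewrite !elZ !elD; congr el; field.
  - by exists 1, 0, 0; rewrite !elZ !elD; congr el; ring.
  - by exists 0, 0, m; rewrite !elZ !elD; congr el; ring.
  - by exists p, 2^-1, (k * m); rewrite !elZ !elD; congr el; field.
apply: (equivalent_span3 dP dQ PU _ PW _ QV); try by rewrite mulmx0 mul0mx.
by rewrite -scalemxAr QV scalemxAl.
Qed.

Lemma L30_classification S : subalgebra S -> isom_L3 0 S ->
  exists2 L, L \in L30 & equivalent S L.
Proof.
move=> subS isoS.
have one0 := oner_neq0 C.
have [e1 [e2 [c1 [c2 [w1 [w2 [SE [[te1 te2 tc1 tc2] [tw1 tw2]]]]]]]]] :=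
  so4_eigenbasis (addr0 1) (etrans (mulr0 1) (esym (oppr0 _))) one0 subS isoS.
rewrite !scale0r !scale1r SE.
move=> [e0 c0] [ec1 we1 wc1] [ec2 we2 wc2].
(* In a factor where e is nonzero, e and w form a Borel pair, whose centralizer is zero; so c has no
   component there. *)
have central U V W : \tr U = 0 -> \tr V = 0 -> \tr W = 0 ->
    br W U = U -> br U V = 0 -> br W V = 0 -> U = 0 \/ V = 0.
  move=> tU tV tW WU UV WV; have [->|U0] := eqVneq U 0; first by left.
  rewrite -[U in RHS]scale1r in WU.
  by right; exact: (borel_centralizer tW tU tV one0 U0 WU WV UV).
have [e10|c10] := central _ _ _ te1 tc1 tw1 we1 ec1 wc1;
  have [e20|c20] := central _ _ _ te2 tc2 tw2 we2 ec2 wc2.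
- by rewrite e10 e20 !eqxx in e0.
- move: e0 c0; rewrite e10 c20 !eqxx andbT /= => e20 c10.
  exact: (L30_normal_forml tc1 te2 tw1 tw2 c10 e20 wc1 we2).
- move: e0 c0; rewrite e20 c10 !eqxx andbT /= => e10 c20.
  exact: (L30_normal_formr te1 tc2 tw1 tw2 e10 c20 we1 wc2).
- by rewrite c10 c20 !eqxx in c0.
Qed.

(** * Conjugation invariants separating the four algebras for a = 0 *)

Definition nonnil_l S := exists U V, blk U V \in S /\ \det U != 0.
Definition nonnil_r S := exists U V, blk U V \in S /\ \det V != 0.
(** Both projections of [L301] and of [L303] contain non-nilpotent elements, so this pair needs
    another invariant: whether the projection to the first factor is abelian. *)
Definition noncomm_l S := exists U V U' V',
  [/\ blk U V \in S, blk U' V' \in S & br U U' != 0].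

Lemma nonnil_l_equivalent S S' : equivalent S S' -> nonnil_l S -> nonnil_l S'.
Proof.
case/equivalent_mem=> P [Q [uP uQ PQ]] [U [V [/PQ UV dU]]].
by do 2!eexists; split; [exact: UV | rewrite det_conj].
Qed.

Lemma nonnil_r_equivalent S S' : equivalent S S' -> nonnil_r S -> nonnil_r S'.
Proof.
case/equivalent_mem=> P [Q [uP uQ PQ]] [U [V [/PQ UV dV]]].
by do 2!eexists; split; [exact: UV | rewrite det_conj].
Qed.

Lemma noncomm_l_equivalent S S' :
  equivalent S S' -> noncomm_l S -> noncomm_l S'.
Proof.
case/equivalent_mem=> P [Q [uP uQ PQ]] [U [V [U' [V' [/PQ UV /PQ UV' br0]]]]].
by do 4!eexists; split; [exact: UV | exact: UV' | rewrite br_conj // conj_eq0].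
Qed.

Lemma det_h_neq0 : \det (sl 1 0 0 : 'M[C]_2) != 0.
Proof. by rewrite det_mx2 mul0r subr0 mul1r oppr_eq0 oner_eq0. Qed.

Lemma L301_nonnil_l : nonnil_l L301.
Proof.
exists (sl 1 0 0), (sl 0 0 0); split; last exact: det_h_neq0.
by rewrite L301_el memv_span // !inE eqxx.
Qed.

Lemma L303_nonnil_l : nonnil_l L303.
Proof.
exists (sl 1 0 0), (sl 0 0 0); split; last exact: det_h_neq0.
by rewrite L303_el memv_span // !inE eqxx orbT.
Qed.

Lemma L302_nil_l : ~ nonnil_l L302.
Proof.
case=> U [V []]; rewrite L302_el => /memv_span3[x [y [t]]].
rewrite !elZ !elD => /blk_inj[-> _].
by rewrite det_mx2 !(mulr0, mulr1, addr0, add0r, oppr0, subr0, eqxx).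
Qed.

Lemma L301_nonnil_r : nonnil_r L301.
Proof.
exists (sl 0 0 0), (sl 1 0 0); split; last exact: det_h_neq0.
by rewrite L301_el memv_span // !inE eqxx !orbT.
Qed.

Lemma L302_nonnil_r : nonnil_r L302.
Proof.
exists (sl 0 0 0), (sl 1 0 0); split; last exact: det_h_neq0.
by rewrite L302_el memv_span // !inE eqxx !orbT.
Qed.

Lemma L303_nonnil_r : nonnil_r L303.
Proof.
exists (sl 0 0 0), (sl 1 0 0); split; last exact: det_h_neq0.
by rewrite L303_el memv_span // !inE eqxx !orbT.
Qed.

Lemma L304_nil_r : ~ nonnil_r L304.
Proof.
case=> U [V []]; rewrite L304_el => /memv_span3[x [y [t]]].
rewrite !elZ !elD => /blk_inj[_ ->].
by rewrite det_mx2 !(mulr0, mulr1, addr0, add0r, oppr0, subr0, eqxx).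
Qed.

Lemma L303_noncomm_l : noncomm_l L303.
Proof.
exists (sl 1 0 0), (sl 0 0 0), (sl 0 1 0), (sl 0 0 0); split.
- by rewrite L303_el memv_span // !inE eqxx orbT.
- by rewrite L303_el memv_span // !inE eqxx.
- rewrite br_sl -sl0; apply/eqP => /sl_inj[_ /eqP + _].
  by rewrite !(mulr0, mulr1, subr0) pnatr_eq0.
Qed.

Lemma L301_comm_l : ~ noncomm_l L301.
Proof.
case=> U [V [U' [V' []]]]; rewrite L301_el.
move=> /memv_span3[x [y [t]]] + /memv_span3[x' [y' [t']]].
rewrite !elZ !elD => /blk_inj[-> _] /blk_inj[-> _].
by rewrite br_sl !(mulr0, mul0r, addr0, subr0) sl0 eqxx.
Qed.

Lemma L30_not_equivalent i j : (i < size L30)%N -> (j < size L30)%N -> i <> j ->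
  ~ equivalent (nth 0%VS L30 i) (nth 0%VS L30 j).
Proof.
(* Equivalence is symmetric, so six ordered pairs suffice. Nilpotency of a projection singles out
   [L302] on the left and [L304] on the right. *)
have lt_case (k l : nat) : (l < 4)%N -> (k < l)%N ->
    ~ equivalent (nth 0%VS L30 k) (nth 0%VS L30 l).
  case: k l => [|[|[|k]]] [|[|[|[|l]]]] //= _ _ eqv.
  - exact: L302_nil_l (nonnil_l_equivalent eqv L301_nonnil_l).
  - exact: L301_comm_l
      (noncomm_l_equivalent (equivalent_sym eqv) L303_noncomm_l).
  - exact: L304_nil_r (nonnil_r_equivalent eqv L301_nonnil_r).
  - exact: L302_nil_l (nonnil_l_equivalent (equivalent_sym eqv) L303_nonnil_l).
  - exact: L304_nil_r (nonnil_r_equivalent eqv L302_nonnil_r).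
  - exact: L304_nil_r (nonnil_r_equivalent eqv L303_nonnil_r).
move=> i4 j4 /eqP; rewrite neq_ltn => /orP[] ltij.
  exact: lt_case.
by move/equivalent_sym; apply: lt_case.
Qed.

End Classification.

Theorem theorem5p6 (R : realType) :
  [/\ forall a : R[i], a <> - (1 / 4) -> a <> 0 ->
        classifies a [:: L3a1 a; L3a2 a],
      ~ (exists S : {vspace 'M[R[i]]_(2 + 2)},
           subalgebra S /\ isom_L3 (- (1 / 4)) S)
    & classifies (0 : R[i]) [:: L301; L302; L303; L304]].
Proof.
split.
- move=> a /eqP a4 /eqP a0.
  set s := sqrtC (1 + 4 * a).
  have sE : s ^+ 2 = 1 + 4 * a by rewrite sqrtCK.
  have four0 : 4 != 0 :> R[i] by rewrite pnatr_eq0.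
  (* The value s = 0 corresponds to a = -1/4, and s^2 = 1 to a = 0. *)
  have s0 : s != 0.
    rewrite sqrtC_eq0; apply: contraNneq a4 => e.
    by apply/eqP; apply: (mulfI four0); rewrite -[LHS](addKr 1) e; field.
  have s1 : s ^+ 2 != 1.
    by rewrite sE -subr_eq0 addrC addKr mulf_neq0.
  have sNE : (- s) ^+ 2 = 1 + 4 * a by rewrite sqrrN.
  have sN0 : - s != 0 by rewrite oppr_eq0.
  have -> : L3a1 a = L3s s by [].
  (* Changing the branch of the square root would only exchange the two algebras; below, s enters
     solely as a nonzero root of 1 + 4a with s^2 <> 1. *)
  have -> : L3a2 a = L3s (- s) by rewrite /L3s opprK.
  split.
  + move=> L; rewrite !inE => /orP[] /eqP ->.
      have iso := L3s_isom sE s0.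
      by split=> //; apply: isom_L3_subalgebra iso; apply: L3s_so4.
    have iso := L3s_isom sNE sN0.
    by split=> //; apply: isom_L3_subalgebra iso; apply: L3s_so4.
  + move=> [|[|i]] [|[|j]] //= _ _ _.
      exact: L3s_not_equivalent.
    by move/equivalent_sym; exact: L3s_not_equivalent.
  + move=> S subS isoS.
    have [eqv|eqv] := L3s_classification sE s0 a0 subS isoS.
      by exists (L3s s); rewrite ?inE ?eqxx.
    by exists (L3s (- s)); rewrite ?inE ?eqxx ?orbT.
- by case=> S; apply: no_L3_quarter.
- split.
  + move=> L LL; have iso := L30_isom LL.
    by split=> //; apply: isom_L3_subalgebra iso; exact: L30_so4.
  + exact: L30_not_equivalent.
  + exact: L30_classification.
Qed.
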